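(* Let $H$ and $K$ be second countable locally compact groups, let $\tau:H\to Aut(K)$ be a continuous homomorphism and let $G_\tau=H\ltimes_\tau K$. Then the $\tau$-convolution $\stackrel{\tau}{\ast}$ on $L^1(G_\tau)$ coincides with the standard convolution of $L^1(G_\tau)$ if and only if $H$ is the trivial group.
   Context: $H,K$ have left Haar measures $dh$ (also written $dt$) and $dk$ (also $ds$). A homomorphism $\tau:H\to Aut(K)$, $h\mapsto\tau_h$, is called continuous if $(h,k)\mapsto\tau_h(k)$ is continuous from $H\times K$ to $K$. The semidirect product $G_\tau=H\ltimes_\tau K$ is the set $H\times K$ with the product topology and the operation $(h,k)\ltimes_\tau(h',k')=(hh',k\tau_h(k'))$. The continuous homomorphism $\delta:H\to(0,\infty)$ is given by $dk=\delta(h)\,d(\tau_h(k))$, i.e. $|E|=\delta(h)|\tau_h(E)|$ for Haar measure $|\cdot|$ on $K$; a left Haar measure of $G_\tau$ is $d\mu_{G_\tau}(h,k)=\delta(h)\,dh\,dk$, and $L^1(G_\tau)$ is taken with respect to it. (When $H$ is trivial its Haar measure is the unit point mass, so that $G_\tau=K$.) For $f\in L^1(G_\tau)$ and $t\in H$ put $f_t(k)=f(t,k)$. With $\ast$ the standard convolution on $L^1(K)$, for $f,g\in L^1(G_\tau)$ put $$f\stackrel{\tau_r}{\ast}g(h,k)=\int_H f_h\ast g_t(k)\,\delta(t)\,dt,\qquad f\stackrel{\tau_l}{\ast}g(h,k)=\int_H f_t\ast g_h(k)\,\delta(t)\,dt,$$ and define the $\tau$-convolution $f\stackrel{\tau}{\ast}g=2^{-1}(f\stackrel{\tau_r}{\ast}g+f\stackrel{\tau_l}{\ast}g)$.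 The standard convolution on $L^1(G)$ for a locally compact group $G$ is $f\ast g(x)=\int_G f(y)g(y^{-1}x)\,dy$. *)

(* Defs.v *)
From HB Require Import structures.
From mathcomp Require Import all_boot all_order all_algebra.
From mathcomp Require Import all_classical all_reals all_analysis.
From mathcomp.real_closed Require Export complex.

Set Implicit Arguments.
Unset Strict Implicit.
Unset Printing Implicit Defensive.

Import Order.TTheory GRing.Theory Num.Theory.
Import numFieldNormedType.Exports.

Local Open Scope classical_set_scope.
Local Open Scope ring_scope.
Local Open Scope complex_scope.

(* The distinguished point inherited from PointedTopological carries no meaning
   (it need not be the identity): it is only there because measurable types are
   pointed. *)
HB.mixin Record isTopologicalGroup G & PointedTopological G & Group G := {
  mulg_continuous : continuous (fun x : G * G => (x.1 * x.2)%g);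
  invg_continuous : continuous (fun x : G => x^-1%g)
}.

#[short(type="topologicalGroupType")]
HB.structure Definition TopologicalGroup :=
  {G of PointedTopological G & Group G & isTopologicalGroup G}.

(* Locally compact groups are Hausdorff by convention. *)
Definition lcsc_group (G : topologicalGroupType) :=
  [/\ hausdorff_space G, locally_compact [set: G] & @second_countable G].

(* G with its Borel sigma-algebra *)
Notation borel G := (g_sigma_algebraType (@open G)).

Section haar.
Context (R : realType) (G : topologicalGroupType).

Record left_haar (mu : {measure set (borel G) -> \bar R}) : Prop := LeftHaar {
  left_haar_neq0 : mu [set: G] != 0%E;
  left_haar_compact : forall C : set G, measurable (C : set (borel G)) ->
    compact C -> (mu C < +oo)%E;
  left_haar_outer : forall E : set G, measurable (E : set (borel G)) ->
    mu E = ereal_inf [set mu U | U in [set U : set G | open U /\ E `<=` U]];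
  left_haar_inner : forall U : set G, open U ->
    mu U = ereal_sup [set mu C | C in [set C : set G |
      [/\ measurable (C : set (borel G)), compact C & C `<=` U]]];
  left_haar_invariant : forall (x : G) (E : set G),
    measurable (E : set (borel G)) -> mu [set (x * y)%g | y in E] = mu E
}.

End haar.

Section complex_integration.
Context d (T : measurableType d) (R : realType).
Variable mu : set T -> \bar R.

(* f is (a representative of an element of) L^1(mu). *)
Definition L1 (f : T -> R[i]) : Prop :=
  mu.-integrable [set: T] (EFin \o (fun x => complex.Re (f x))) /\
  mu.-integrable [set: T] (EFin \o (fun x => complex.Im (f x))).

(* When f is not in L^1(mu), the value is meaningless.  For the convolutions
   below of L^1 functions this affects only a null set of points. *)
Definition cintegral (f : T -> R[i]) : R[i] :=
  fine (\int[mu]_x (complex.Re (f x))%:E)%E +i*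
  fine (\int[mu]_x (complex.Im (f x))%:E)%E.

End complex_integration.

Definition convolution (R : realType) (G : topologicalGroupType)
    (mu : set (borel G) -> \bar R) (f g : G -> R[i]) : G -> R[i] :=
  fun x => cintegral mu (fun y : G => f y * g (y^-1 * x)%g).

(* A continuous homomorphism tau : H -> Aut(K). Each tau_h is bijective, with
   continuous inverse tau_(h^-1), by the last three fields. *)
Record cont_hom_Aut (H K : topologicalGroupType) := ContHomAut {
  tau_fun :> H -> K -> K;
  tau_mulg : forall h, {morph tau_fun h : k k' / (k * k')%g};
  tau_id : forall k, tau_fun 1%g k = k;
  tau_comp : forall h h' k, tau_fun (h * h')%g k = tau_fun h (tau_fun h' k);
  tau_continuous : continuous (fun p : H * K => tau_fun p.1 p.2)
}.

Definition semidirect (H K : topologicalGroupType) (tau : cont_hom_Aut H K) :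
  Type := (H * K)%type.

Section semidirect_group.
Context (H K : topologicalGroupType) (tau : cont_hom_Aut H K).
Local Notation G := (semidirect tau).

Definition sd_one : G := (1%g, 1%g).
Definition sd_mul (x y : G) : G := ((x.1 * y.1)%g, (x.2 * tau x.1 y.2)%g).
Definition sd_inv (x : G) : G := (x.1^-1%g, tau x.1^-1%g x.2^-1%g).

Let tau1 h : tau h 1%g = 1%g.
Proof. by apply: (@mulgI _ (tau h 1%g)); rewrite -tau_mulg !mulg1. Qed.

Let sd_mulA : associative sd_mul.
Proof.
by move=> x y z; rewrite /sd_mul /= tau_mulg tau_comp !mulgA.
Qed.

Let sd_mul1 : left_id sd_one sd_mul.
Proof. by case=> h k; rewrite /sd_mul /= tau_id !mul1g. Qed.

Let sd_mulr1 : right_id sd_one sd_mul.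
Proof. by case=> h k; rewrite /sd_mul /= tau1 !mulg1. Qed.

Let sd_mulV : left_inverse sd_one sd_inv sd_mul.
Proof. by case=> h k; rewrite /sd_mul /= -tau_mulg !mulVg tau1. Qed.

Let sd_mulrV : right_inverse sd_one sd_inv sd_mul.
Proof. by case=> h k; rewrite /sd_mul /= -tau_comp !mulgV tau_id mulgV. Qed.

HB.instance Definition _ := Pointed.copy G (H * K)%type.
HB.instance Definition _ := Topological.copy G (H * K)%type.
HB.instance Definition _ :=
  isGroup.Build G sd_mulA sd_mul1 sd_mulr1 sd_mulV sd_mulrV.

Let sd_mul_continuous : continuous (fun x : G * G => (x.1 * x.2)%g).
Proof.
move=> [[h k] [h' k']].
have f11 : (fun x : G * G => x.1.1) @ ((h, k), (h', k')) --> h.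
  by apply: (cvg_comp fst fst); [exact: cvg_fst|exact: cvg_fst].
have f12 : (fun x : G * G => x.1.2) @ ((h, k), (h', k')) --> k.
  by apply: (cvg_comp fst snd); [exact: cvg_fst|exact: cvg_snd].
have f21 : (fun x : G * G => x.2.1) @ ((h, k), (h', k')) --> h'.
  by apply: (cvg_comp snd fst); [exact: cvg_snd|exact: cvg_fst].
have f22 : (fun x : G * G => x.2.2) @ ((h, k), (h', k')) --> k'.
  by apply: (cvg_comp snd snd); [exact: cvg_snd|exact: cvg_snd].
apply: cvg_pair.
  apply: (cvg_comp (fun x : G * G => (x.1.1, x.2.1)) (fun p => (p.1 * p.2)%g)).
    exact: cvg_pair f11 f21.
  exact: (@mulg_continuous H (h, h')).
apply: (cvg_comp (fun x : G * G => (x.1.2, tau x.1.1 x.2.2))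
                 (fun p => (p.1 * p.2)%g)); last first.
  exact: (@mulg_continuous K (k, tau h k')).
apply: cvg_pair => //.
apply: (cvg_comp (fun x : G * G => (x.1.1, x.2.2)) (fun p => tau p.1 p.2)).
  exact: cvg_pair f11 f22.
exact: (@tau_continuous _ _ tau (h, k')).
Qed.

Let sd_inv_continuous : continuous (fun x : G => x^-1%g).
Proof.
move=> [h k].
have f1 : (fun x : G => x.1^-1%g) @ ((h, k) : G) --> h^-1%g.
  by apply: (cvg_comp fst (fun y => y^-1%g)); [exact: cvg_fst|exact: invg_continuous].
have f2 : (fun x : G => x.2^-1%g) @ ((h, k) : G) --> k^-1%g.
  by apply: (cvg_comp snd (fun y => y^-1%g)); [exact: cvg_snd|exact: invg_continuous].
apply: cvg_pair => //.
apply: (cvg_comp (fun x : G => (x.1^-1%g, x.2^-1%g)) (fun p => tau p.1 p.2)).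
  exact: cvg_pair f1 f2.
exact: (@tau_continuous _ _ tau (h^-1%g, k^-1%g)).
Qed.

HB.instance Definition _ :=
  isTopologicalGroup.Build G sd_mul_continuous sd_inv_continuous.

End semidirect_group.

Section tau_convolution.
Context (R : realType) (H K : topologicalGroupType) (tau : cont_hom_Aut H K).
Variables (muH : {measure set (borel H) -> \bar R})
          (muK : {measure set (borel K) -> \bar R}) (delta : H -> R).
Local Notation G := (semidirect tau).

(* delta : H -> (0, oo) with dk = delta(h) d(tau_h(k)). *)
Record is_delta : Prop := IsDelta {
  delta_gt0 : forall h, 0 < delta h;
  deltaM : forall h h', delta (h * h')%g = delta h * delta h';
  delta_continuous : continuous delta;
  delta_haar : forall (h : H) (E : set K), measurable (E : set (borel K)) ->
    muK E = ((delta h)%:E * muK [set tau h k | k in E])%E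
}.

(* The measure delta(h) dh dk on the Borel sets of H x K. *)
Definition semidirect_haar : set (borel G) -> \bar R :=
  fun E => (\int[muH]_h ((delta h)%:E * muK (xsection E h)))%E.

Definition tau_conv_r (f g : G -> R[i]) : G -> R[i] := fun x =>
  cintegral muH (fun t : H =>
    convolution muK (fun s => f (x.1, s)) (fun s => g (t, s)) x.2 * (delta t)%:C).

Definition tau_conv_l (f g : G -> R[i]) : G -> R[i] := fun x =>
  cintegral muH (fun t : H =>
    convolution muK (fun s => f (t, s)) (fun s => g (x.1, s)) x.2 * (delta t)%:C).

Definition tau_conv (f g : G -> R[i]) : G -> R[i] := fun x =>
  2^-1 * (tau_conv_r f g x + tau_conv_l f g x).

End tau_convolution.

Arguments semidirect_haar {R H K} tau muH muK delta.

(* Main.v *)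
From HB Require Import structures.
Require Import Defs.
From mathcomp Require Import all_boot all_order all_algebra.
From mathcomp Require Import all_classical all_reals all_analysis.
From mathcomp Require Import measurable_realfun.
From mathcomp.real_closed Require Import complex.

Set Implicit Arguments.
Unset Strict Implicit.
Unset Printing Implicit Defensive.

Import Order.TTheory GRing.Theory Num.Theory.
Import numFieldNormedType.Exports.

Local Open Scope classical_set_scope.
Local Open Scope ring_scope.

(** The proof is an argument about supports. Write |.|_d for the measure
delta(t) dt on H. For f the indicator of V x C and g the indicator of V x D,
both halves of the tau-convolution of f and g equal
  1_V(h) * |V|_d * (1_C * 1_D)(k),
so the tau-convolution lives over V. Each half keeps the H-coordinate of one of
its arguments. The standard convolution multiplies H-coordinates, and lives
over V V.

Suppose H has an element a <> 1. Then a * a <> a, so some neighbourhood V of a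
is disjoint from V V ([separating_nbhd]), and the standard convolution vanishes
over V ([rect_indic_convolution]). In K take an open neighbourhood D of 1 of
finite measure and an open C containing 1 with C^-1 C inside D. Then
(1_C * 1_D)(k) = |C| for k in C, and the tau-convolution is the positive
constant |V|_d * |C| on V x C ([rect_indic_tau_conv]). As V x C has measure
|V|_d * |C| > 0, the two convolutions differ on a set that is not null.

Conversely, if H is trivial then every integral over H is the value at 1 and
the measure of the semidirect product is the image of the Haar measure of K
under k |-> (1, k). All three convolutions of L^1 functions become the
convolution of K ([tau_conv_trivial]).

The semidirect Haar measure is given as a set function on the Borel sets of
H x K, as an integral over H of the measures of sections. Second countability
makes it a measure: the Borel sets of H x K then belong to the product
sigma-algebra ([borel_prod]), and local compactness makes the Haar measure of
K sigma-finite ([haar_sigma_finite]), so the measure of a section depends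
measurably on its base point ([semidirect_haar_measure]). *)

(** * Borel sets of second countable spaces *)

Lemma borel_open (T : ptopologicalType) (U : set T) :
  open U -> measurable (U : set (borel T)).
Proof. by move=> oU; exact: sub_sigma_algebra. Qed.

(** The Lindelof property, for covers by sets that are small in the sense of a
hereditary predicate [P]: the basic open sets that are themselves small already
cover the space, and there are countably many of them. *)
Lemma second_countable_cover (T : ptopologicalType) (P : set T -> Prop) :
    @second_countable T ->
    (forall A B, A `<=` B -> P B -> P A) ->
    (forall x : T, exists2 U : set T, nbhs x U & P U) ->
  exists2 F : nat -> set T, forall n, open (F n) /\ P (F n) &
    \bigcup_n F n = setT.
Proof.
move=> [B cB [oB nB]] Psub Pnbhs.
pose x0 : T := point.
have P0 : P set0 by have [U _ /(Psub set0)] := Pnbhs x0; apply.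
case/pfcard_geP: cB => [BE|[e]].
  by have [U Ux _] := Pnbhs x0; have [W [/= + _] _] := nB x0 U Ux; rewrite BE.
(* Basic open sets that are not small are replaced by the empty set. *)
exists (fun n => if asbool (P (e n)) then e n else set0).
  move=> n; case: asboolP => // Pn; first by split => //; apply: oB; exact: funS.
  by split => //; exact: open0.
apply/seteqP; split => // x _.
have [U Ux PU] := Pnbhs x; have [W [/= BW Wx] WU] := nB x U Ux.
have [n _ en] := @surj _ _ _ _ e W BW.
by exists n => //; rewrite en asboolT//; exact: Psub PU.
Qed.

Lemma open_setX (S T : topologicalType) (U : set S) (V : set T) :
  open U -> open V -> open (U `*` V).
Proof.
move=> oU oV; rewrite openE => -[x y] [/= Ux Vy].
by exists (U, V) => //; split; exact: open_nbhs_nbhs.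
Qed.

(** An open set of the product is the union of the basic rectangles that it
contains, of which there are countably many. *)
Lemma open_prod_borel (S T : ptopologicalType) (U : set (S * T)) :
    @second_countable S -> @second_countable T -> open U ->
  measurable (U : set (borel S * borel T)).
Proof.
move=> [B cB [oB nB]] [C cC [oC nC]] oU.
have -> : U = \bigcup_(p in (B `*` C) `&` [set p | p.1 `*` p.2 `<=` U])
    (p.1 `*` p.2).
  apply/seteqP; split=> [[x y] Uxy|z [p [_]]]; last by apply.
  have [[V W] /= [Vx Wy] VWU] : nbhs (x, y) U by exact: open_nbhs_nbhs.
  have [V' [/= BV' V'x] V'V] := nB _ _ Vx.
  have [W' [/= BW' W'y] W'W] := nC _ _ Wy.
  exists (V', W') => //; split => // -[a b] /= [/V'V Va /W'W Wb].
  exact: VWU.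
rewrite bigcup_set_type; apply: countable_bigcupT_measurable.
  rewrite (eq_countable (card_setT _)).
  apply: sub_countable (countableX cB cC).
  by apply: subset_card_le; exact: subIsetl.
move=> [[V W] /= /set_mem[[/= /oB oV /oC oW] _]].
by apply: measurableX; exact: borel_open.
Qed.

Lemma borel_prod (S T : ptopologicalType) (U : set (S * T)) :
    @second_countable S -> @second_countable T ->
    measurable (U : set (borel (S * T)%type)) ->
  measurable (U : set (borel S * borel T)).
Proof.
move=> cS cT; move: U; apply: smallest_sub; first exact: sigma_algebra_measurable.
by move=> U /= oU; exact: open_prod_borel.
Qed.

Lemma continuous_borel (S T : ptopologicalType) (f : S -> T) :
  continuous f -> measurable_fun setT (f : borel S -> borel T).
Proof.
move=> cf; apply: (@measurability _ _ (borel S) (borel T) _ _ (@open T)) => //.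
move=> _ [U oU <-].
by rewrite setTI; apply: borel_open; move/continuousP: cf; apply.
Qed.

Lemma continuous_borel_real (R : realType) (S : ptopologicalType) (f : S -> R) :
  continuous f -> measurable_fun setT (f : borel S -> R).
Proof.
move=> cf; apply: (measurability _ (RGenOpens.measurableE R)).
move=> _ [_ [a [b ->]] <-]; rewrite setTI; apply: borel_open.
by move/continuousP: cf; apply; exact: interval_open.
Qed.
(** * Translations and quotients in topological groups *)

Lemma mulgl_continuous (G : topologicalGroupType) (x : G) :
  continuous (fun y : G => (x * y)%g).
Proof.
move=> y; apply: (cvg_comp (fun y : G => (x, y)) (fun p => (p.1 * p.2)%g) _
  (@mulg_continuous G (x, y))).
exact: (cvg_pair (@cvg_cst G x G (nbhs y) _) (@cvg_id _ _)).
Qed.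

Lemma open_translate (G : topologicalGroupType) (x : G) (U : set G) :
  open U -> open [set (x * y)%g | y in U].
Proof.
move=> oU; have -> : [set (x * y)%g | y in U] = (fun y => x^-1 * y)%g @^-1` U.
  apply/seteqP; split => [_ [y Uy <-] /=|y /= Uy]; first by rewrite mulKg.
  by exists (x^-1 * y)%g => //; rewrite mulVKg.
by move/continuousP: (@mulgl_continuous G x^-1%g); apply.
Qed.

Lemma ldiv_continuous (G : topologicalGroupType) :
  continuous (fun p : G * G => p.1^-1 * p.2)%g.
Proof.
move=> [x y].
have c1 : (fun p : G * G => p.1^-1%g) @ (x, y) --> x^-1%g.
  apply: (cvg_comp fst (fun z => z^-1%g)); first exact: cvg_fst.
  exact: invg_continuous.
have c2 : (fun p : G * G => p.2) @ (x, y) --> y by exact: cvg_snd.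
apply: (cvg_comp (fun p : G * G => (p.1^-1, p.2)%g) (fun p => p.1 * p.2)%g).
  exact: cvg_pair c1 c2.
exact: (@mulg_continuous G (x^-1, y)%g).
Qed.

Lemma nbhs_ldiv (G : topologicalGroupType) (a : G) (D : set G) :
    nbhs 1%g D ->
  exists2 V : set G, open_nbhs a V & forall x y, V x -> V y -> D (x^-1 * y)%g.
Proof.
move=> D1; have := @ldiv_continuous G (a, a); rewrite /continuous_at /= mulVg.
move=> /(_ D D1)[[V W] /= [Va Wa] VWD].
exists (interior (V `&` W)).
  by split; [exact: open_interior|exact: filterI].
by move=> x y /interior_subset[Vx _] /interior_subset[_ Wy]; exact: (VWD (x, y)).
Qed.

(** * Haar measures of locally compact second countable groups *)

Section haar_theory.
Context (R : realType) (G : topologicalGroupType).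
Variable mu : {measure set (borel G) -> \bar R}.
Hypotheses (lcscG : lcsc_group G) (haarG : left_haar mu).

Lemma haar_locally_finite (x : G) :
  exists2 U : set G, open_nbhs x U & (mu U < +oo)%E.
Proof.
have [_ /(_ x I)[U /= xU [cU clU]] _] := lcscG.
have {}xU : nbhs x U by move: xU; rewrite within_interior ?interiorT.
have mU : measurable (U : set (borel G)).
  rewrite -(setCK U); apply: (@measurableC _ (borel G)); apply: borel_open.
  exact: closed_openC.
exists (interior U); first by split; [exact: open_interior|].
apply: le_lt_trans (left_haar_compact haarG mU cU).
apply: le_measure; rewrite ?inE//; last exact: interior_subset.
by apply: borel_open; exact: open_interior.
Qed.

Lemma haar_sigma_finite : sigma_finite [set: borel G] mu.
Proof.
have [_ _ scG] := lcscG.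
have [||F oF FT] := @second_countable_cover G
  (fun A => exists2 U, open U /\ (mu U < +oo)%E & A `<=` U) scG.
- by move=> A B AB [U oU BU]; exists U => //; exact: subset_trans BU.
- move=> x; have [U [oU Ux] Uoo] := haar_locally_finite x.
  by exists U; [exact: open_nbhs_nbhs|exists U].
exists F => // n; have [oFn [U [oU Uoo] FU]] := oF n.
split; first exact: borel_open.
apply: le_lt_trans Uoo; apply: le_measure; rewrite ?inE//; exact: borel_open.
Qed.

(** If an open set is null, so are its translates; countably many open sets
contained in translates of it cover the group, which would then be null. *)
Lemma haar_open_gt0 (U : set G) : open U -> U !=set0 -> (0 < mu U)%E.
Proof.
move=> oU [u Uu]; rewrite lt0e measure_ge0 andbT; apply/eqP => U0.
have [_ _ scG] := lcscG.
have [||F oF FT] := @second_countable_cover G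
  (fun A => exists x, A `<=` [set (x * y)%g | y in U]) scG.
- by move=> A B AB [x BU]; exists x; exact: subset_trans BU.
- move=> x; exists [set (x * u^-1 * y)%g | y in U]; last by exists (x * u^-1)%g.
  apply: open_nbhs_nbhs; split; first exact: open_translate.
  by exists u => //; rewrite mulgVK.
suff : mu.-negligible [set: borel G].
  by move=> /negligibleP => /(_ measurableT) /eqP; exact/negP/left_haar_neq0.
rewrite -FT; apply: negligible_bigcup => n; have [oFn [x FU]] := oF n.
apply: (@negligibleS _ (borel G) _ mu _ _ FU).
have mxU : measurable ([set (x * y)%g | y in U] : set (borel G)).
  by apply: borel_open; exact: open_translate.
apply/negligibleP => //.
exact: etrans (left_haar_invariant haarG x (borel_open oU)) U0.
Qed.

End haar_theory.

(** * The left Haar measure of the semidirect product *)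

Section semidirect_haar_theory.
Context (R : realType) (H K : topologicalGroupType) (tau : cont_hom_Aut H K).
Variables (muH : {measure set (borel H) -> \bar R})
          (muK : {measure set (borel K) -> \bar R}) (delta : H -> R).
Hypotheses (lcscH : lcsc_group H) (lcscK : lcsc_group K)
  (haarK : left_haar muK) (hdelta : is_delta tau muK delta).
Local Notation G := (semidirect tau).
Local Notation muG := (semidirect_haar tau muH muK delta).
Local Open Scope ereal_scope.

Lemma measurable_semidirect_xsection (E : set G) (h : H) :
  measurable (E : set (borel G)) -> measurable (xsection E h : set (borel K)).
Proof.
have [[_ _ scH] [_ _ scK]] := (lcscH, lcscK) => mE.
by apply: (@measurable_xsection _ _ (borel H) (borel K)); exact: borel_prod.
Qed.

Lemma measurable_fun_delta : measurable_fun [set: borel H] (EFin \o delta).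
Proof.
apply/measurable_EFinP; apply: continuous_borel_real.
exact: (delta_continuous hdelta).
Qed.

Lemma measurable_fun_semidirect_xsection (E : set G) :
    measurable (E : set (borel G)) ->
  measurable_fun [set: borel H] (fun h => (delta h)%:E * muK (xsection E h)).
Proof.
have [[_ _ scH] [_ _ scK]] := (lcscH, lcscK) => mE.
apply: emeasurable_funM; first exact: measurable_fun_delta.
have sfK := haar_sigma_finite lcscK haarK.
pose i1 := isSFinite.Build _ _ _ _ (sfinite_measure_sigma_finite sfK).
pose i2 := isSigmaFinite.Build _ _ _ _ sfK.
pose nu := HB.pack_for {sigma_finite_measure set (borel K) -> \bar R}
  (Measure.sort muK) i1 i2.
exact: (@measurable_fun_xsection _ _ (borel H) (borel K) R nu _
  (borel_prod scH scK mE)).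
Qed.

Let muG_ge0 E h : 0 <= (delta h)%:E * muK (xsection E h).
Proof. by rewrite mule_ge0 ?lee_fin ?(ltW (delta_gt0 hdelta _)). Qed.

Lemma semidirect_haar_measure :
  exists mu : {measure set (borel G) -> \bar R}, mu = muG :> (set G -> \bar R).
Proof.
have m0 : muG set0 = 0.
  by apply: integral0_eq => h _; rewrite xsection0 measure0 mule0.
have mge0 E : 0 <= muG E by apply: integral_ge0 => h _; exact: muG_ge0.
have madd : semi_sigma_additive (muG : set (borel G) -> \bar R).
  move=> F mF tF mUF.
  rewrite [X in _ --> X](_ : _ = \sum_(n <oo) muG (F n)).
    by apply/cvg_closeP; split; [exact: is_cvg_nneseries|rewrite closeE].
  rewrite /semidirect_haar -integral_nneseries//; last first.
    by move=> n; exact: measurable_fun_semidirect_xsection.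
  apply: eq_integral => h _.
  rewrite nneseriesZl ?lee_fin ?(ltW (delta_gt0 hdelta _))//.
  congr (_ * _); apply/esym/cvg_lim => //=; rewrite xsection_bigcup.
  apply: (@measure_sigma_additive _ _ _ muK (fun n => xsection (F n) h)).
    by move=> n; exact: measurable_semidirect_xsection.
  exact: (@trivIset_xsection H K).
pose nu : {measure set (borel G) -> \bar R} :=
  HB.pack (muG : set (borel G) -> \bar R) (isMeasure.Build _ _ _ _ m0 mge0 madd).
by exists nu.
Qed.

Lemma semidirect_haar_setX (V : set H) (C : set K) : open V -> open C ->
  muG (V `*` C) = (\int[muH]_(h in V) (delta h)%:E) * muK C.
Proof.
move=> oV oC; rewrite /semidirect_haar.
rewrite (eq_integral (fun h : borel H =>
  ((EFin \o delta) \_ V) h * muK C)); last first.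
  move=> h _; rewrite patchE; have [hV|hV] := boolP (h \in V).
    by rewrite in_xsectionX.
  by rewrite notin_xsectionX// measure0 mule0 mul0e.
rewrite ge0_integralZr//.
- by rewrite [in RHS]integral_mkcond.
- apply/(measurable_restrictT _ _).1; first exact: borel_open.
  exact: measurable_funTS measurable_fun_delta.
- move=> h _; apply: erestrict_ge0 => x _.
  by rewrite lee_fin (ltW (delta_gt0 hdelta _)).
Qed.

End semidirect_haar_theory.

(** * Disjointness of the supports when H is not trivial *)

(** The quotients t^-1 h of points of a small neighbourhood of [a] are close to
1, hence stay away from [a]. The bounds on [delta], which is continuous and
positive at [a], turn into bounds on its integral because a smaller
neighbourhood still has finite and positive measure. *)
Lemma separating_nbhd (R : realType) (H K : topologicalGroupType)
    (tau : cont_hom_Aut H K) (muH : {measure set (borel H) -> \bar R})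
    (muK : {measure set (borel K) -> \bar R}) (delta : H -> R) (a : H) :
    lcsc_group H -> left_haar muH -> is_delta tau muK delta -> a != 1%g ->
  exists2 V : set H, open_nbhs a V &
    (forall t h, V t -> V h -> ~ V (t^-1 * h)%g) /\
    (0 < \int[muH]_(t in V) (delta t)%:E < +oo)%E.
Proof.
move=> lcscH haarH hdelta a1.
have [+ _ _] := lcscH; rewrite open_hausdorff => /(_ a 1%g a1).
move=> [[B A] /= [/set_mem Ba /set_mem A1] [oB oA /eqP BA0]].
have [V0 [oV0 V0a] V0A] := nbhs_ldiv a (open_nbhs_nbhs (conj oA A1)).
have [V1 [oV1 V1a] V1oo] := haar_locally_finite lcscH haarH a.
have da := delta_gt0 hdelta a.
pose V2 := delta @^-1` `]delta a / 2, delta a + 1[%classic.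
have oV2 : open V2.
  by move/continuousP: (delta_continuous hdelta); apply; exact: interval_open.
have V2a : V2 a.
  by rewrite /V2 /= in_itv/= ltrDl ltr01 andbT gtr_pMr// invf_lt1 ?ltr1n.
pose V := (V0 `&` B) `&` (V1 `&` V2).
have oV : open V by do 2 ?apply: openI => //; exact: openI.
have mV : measurable (V : set (borel H)) by exact: borel_open.
have mdelta : measurable_fun (V : set (borel H)) (EFin \o delta).
  exact: measurable_funTS (measurable_fun_delta hdelta).
have Va : V a by [].
exists V => //; split.
  move=> t h [[V0t _] _] [[V0h _] _] [[_ Bth] _].
  suff : (B `&` A) (t^-1 * h)%g by rewrite BA0.
  by split => //; exact: V0A.
have Voo : (muH V < +oo)%E.
  apply: le_lt_trans V1oo; apply: le_measure; rewrite ?inE//.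
    exact: borel_open.
  by move=> t [_ []].
have Vgt0 : (0 < muH V)%E by apply: haar_open_gt0 => //; exists a.
have bnd t : V t -> delta a / 2 < delta t < delta a + 1.
  by move=> [_ [_]]; rewrite /V2 /= in_itv.
apply/andP; split.
  apply: (@lt_le_trans _ _ (\int[muH]_(t in V) (delta a / 2)%:E)%E).
    by rewrite integral_cst// mule_gt0// lte_fin divr_gt0.
  apply: ge0_le_integral => //.
  - by move=> t _; rewrite lee_fin divr_ge0// ltW.
  - by move=> t /bnd /andP[lt _]; rewrite lee_fin ltW.
apply: (@le_lt_trans _ _ (\int[muH]_(t in V) (delta a + 1)%:E)%E).
  apply: ge0_le_integral => //.
  - by move=> t _; rewrite lee_fin (ltW (delta_gt0 hdelta _)).
  - by move=> t /bnd /andP[_ gt]; rewrite lee_fin ltW.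
by rewrite integral_cst// lte_mul_pinfty// lee_fin addr_ge0// ltW.
Qed.

Lemma cintegral_real d (T : measurableType d) (R : realType)
    (mu : {measure set T -> \bar R}) (r : T -> R) :
  cintegral mu (fun x => (r x)%:C%C) = (fine (\int[mu]_x (r x)%:E)%E)%:C%C.
Proof. by rewrite /cintegral /= integral0. Qed.

Section separating_functions.
Context (R : realType) (H K : topologicalGroupType) (tau : cont_hom_Aut H K).
Variables (muH : {measure set (borel H) -> \bar R})
          (muK : {measure set (borel K) -> \bar R}) (delta : H -> R).
Hypotheses (lcscH : lcsc_group H) (lcscK : lcsc_group K)
  (haarK : left_haar muK) (hdelta : is_delta tau muK delta).
Local Notation G := (semidirect tau).
Local Notation muG := (semidirect_haar tau muH muK delta).

Definition rect_indic (V : set H) (C : set K) : G -> R[i] :=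
  fun x => (\1_(V `*` C) x)%:C%C.

Lemma rect_indic_L1 (V : set H) (C : set K) : open V -> open C ->
  (\int[muH]_(h in V) (delta h)%:E < +oo)%E -> (muK C < +oo)%E ->
  L1 muG (rect_indic V C).
Proof.
move=> oV oC Voo Coo.
have [mu muE] := semidirect_haar_measure muH lcscH lcscK haarK hdelta.
have mVC : measurable (V `*` C : set (borel G)).
  by apply: borel_open; exact: open_setX.
split; last first.
  by rewrite -muE; exact: (@integrable0 _ (borel G) R mu setT).
apply/integrableP; split.
  by apply/measurable_EFinP; exact: (@measurable_indic _ (borel G)).
rewrite -muE (eq_integral (fun x : borel G => (\1_(V `*` C) x)%:E)); last first.
  by move=> x _ /=; rewrite ger0_norm.
rewrite (integral_indic mu measurableT mVC) setIT muE.
rewrite (semidirect_haar_setX muH hdelta oV oC).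
have I0 : (0 <= \int[muH]_(h in V) (delta h)%:E)%E.
  by apply: integral_ge0 => h _; rewrite lee_fin (ltW (delta_gt0 hdelta _)).
by rewrite lte_mul_pinfty// ge0_fin_numE.
Qed.

Variables (V : set H) (C D : set K).
Hypotheses (oV : open V) (oC : open C)
  (VV : forall t h, V t -> V h -> ~ V (t^-1 * h)%g)
  (CD : forall s k, C s -> C k -> D (s^-1 * k)%g).

(** The integrand at (t, s) is nonzero only if both t and t^-1 h are in V. *)
Lemma rect_indic_convolution (h : H) (k : K) : V h ->
  convolution muG (rect_indic V C) (rect_indic V D) (h, k) = 0.
Proof.
move=> Vh.
have [mu muE] := semidirect_haar_measure muH lcscH lcscK haarK hdelta.
rewrite /convolution -muE.
rewrite (_ : (fun y : G => _) = (fun y : borel G => (0 : R)%:C%C)).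
  by rewrite cintegral_real integral0.
apply/funext => -[t s]; rewrite /rect_indic !indicE !in_setX /=.
have [tV|_] := boolP (t \in V); last by rewrite /= mul0r.
rewrite [(t^-1 * h)%g \in V]memNset ?mulr0//.
by apply: VV => //; exact: set_mem.
Qed.

(** For k in C the factor 1_D(s^-1 k) is 1 on all of C, so the convolution on K
reduces to the measure of C. The two equations serve the right and left halves
of the tau-convolution. *)
Let rect_indic_convolution_slice (h t : H) (k : K) : V h -> C k ->
  convolution muK (fun s => rect_indic V C (h, s))
      (fun s => rect_indic V D (t, s)) k =
    (\1_V t * fine (muK C))%:C%C /\
  convolution muK (fun s => rect_indic V C (t, s))
      (fun s => rect_indic V D (h, s)) k =
    (\1_V t * fine (muK C))%:C%C.
Proof.
move=> Vh Ck.
have -> : (\1_V t * fine (muK C))%:C%C =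
    cintegral muK (fun s : borel K => (\1_V t * \1_C s)%:C%C).
  rewrite cintegral_real; congr (_%:C)%C.
  have [tV|tV] := boolP (t \in V); rewrite indicE ?tV ?(negbTE tV).
    under eq_integral do rewrite mul1r.
    by rewrite mul1r integral_indic ?setIT//; exact: borel_open.
  by under eq_integral do rewrite mul0r; rewrite mul0r integral0.
rewrite /convolution; split; congr cintegral; apply/funext => s.
  rewrite /rect_indic !indicE !in_setX /= (mem_set Vh) /= -rmorphM/=.
  have [sC|] := boolP (s \in C); last by rewrite mul0r mulr0.
  rewrite [_ \in D]mem_set ?andbT ?mul1r ?mulr1//.
  by apply: CD => //; exact: set_mem.
rewrite /rect_indic !indicE !in_setX /= (mem_set Vh) /= -rmorphM/=.
have [sC|] := boolP (s \in C); last by rewrite andbF mul0r mulr0.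
by rewrite [_ \in D]mem_set ?andbT//; apply: CD => //; exact: set_mem.
Qed.

Lemma rect_indic_tau_conv (h : H) (k : K) : V h -> C k ->
    (\int[muH]_(t in V) (delta t)%:E < +oo)%E ->
  tau_conv muH muK delta (rect_indic V C) (rect_indic V D) (h, k) =
  (fine (muK C) * fine (\int[muH]_(t in V) (delta t)%:E)%E)%:C%C.
Proof.
move=> Vh Ck Voo; rewrite /tau_conv /tau_conv_r /tau_conv_l /=.
have d0 t : (0 <= (delta t)%:E)%E by rewrite lee_fin (ltW (delta_gt0 hdelta _)).
have Iint : cintegral muH
    (fun t : borel H => (\1_V t * fine (muK C) * delta t)%:C%C) =
    (fine (muK C) * fine (\int[muH]_(t in V) (delta t)%:E)%E)%:C%C.
  rewrite cintegral_real; congr (_%:C)%C.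
  rewrite (eq_integral (fun t : borel H =>
    (fine (muK C))%:E * ((EFin \o delta) \_ V) t)%E); last first.
    move=> t _; rewrite patchE indicE; case: ifPn => _.
      by rewrite mul1r EFinM.
    by rewrite !mul0r mule0.
  rewrite ge0_integralZl_EFin//.
  - rewrite -integral_mkcond fineM// ge0_fin_numE//.
    by apply: integral_ge0 => t _; exact: d0.
  - by move=> t _; by apply: erestrict_ge0 => x _; exact: d0.
  - apply/(measurable_restrictT _ _).1; first exact: borel_open.
    exact: measurable_funTS (measurable_fun_delta hdelta).
rewrite (_ : (fun t : H => _) =
    (fun t : borel H => (\1_V t * fine (muK C) * delta t)%:C%C)); last first.
  by apply/funext => t; rewrite (rect_indic_convolution_slice t Vh Ck).1 -rmorphM.
rewrite [X in _ * (_ + cintegral _ X)](_ : _ =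
    (fun t : borel H => (\1_V t * fine (muK C) * delta t)%:C%C)); last first.
  by apply/funext => t; rewrite (rect_indic_convolution_slice t Vh Ck).2 -rmorphM.
by rewrite Iint -mulr2n -[X in _ * X]mulr_natl mulrA mulVf ?mul1r ?pnatr_eq0.
Qed.

End separating_functions.

(** * The case of a trivial H *)

Section trivial_factor.

(** The integrand of a convolution of L^1 functions can fail to be integrable at
some points, so the change of variables is made in the positive and negative
parts, where measurability suffices. *)
Lemma cintegral_pushforward d1 d2 (X : measurableType d1)
    (Y : measurableType d2) (R : realType) (mu : {measure set X -> \bar R})
    (phi : X -> Y) (F : Y -> R[i]) :
    measurable_fun setT phi ->
    measurable_fun setT (fun y => complex.Re (F y)) ->
    measurable_fun setT (fun y => complex.Im (F y)) ->
  cintegral (pushforward mu phi) F = cintegral mu (F \o phi).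
Proof.
move=> mphi mRe mIm.
have ge0_intE (u : Y -> \bar R) : measurable_fun setT u ->
    (forall y, 0 <= u y)%E ->
    (\int[pushforward mu phi]_y u y = \int[mu]_x (u \o phi) x)%E.
  move=> ? ?; rewrite -[in RHS](preimage_setT phi).
  exact: ge0_integral_pushforward.
have intE (r : Y -> R) : measurable_fun setT r ->
    (\int[pushforward mu phi]_y (r y)%:E = \int[mu]_x (r (phi x))%:E)%E.
  move=> /measurable_EFinP mr.
  rewrite (integralE (pushforward mu phi) setT (EFin \o r)).
  rewrite (integralE mu setT (EFin \o r \o phi)).
  congr (_ - _)%E.
    rewrite (ge0_intE _ (measurable_funepos mr)); last exact: funepos_ge0.
    by apply: eq_integral => x _; rewrite /= !funeposE.
  rewrite (ge0_intE _ (measurable_funeneg mr)); last exact: funeneg_ge0.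
  by apply: eq_integral => x _; rewrite /= !funenegE.
by rewrite /cintegral !intE.
Qed.

Context (R : realType) (H K : topologicalGroupType) (tau : cont_hom_Aut H K).
Variables (muH : {measure set (borel H) -> \bar R})
          (muK : {measure set (borel K) -> \bar R}) (delta : H -> R).
Hypotheses (hdelta : is_delta tau muK delta) (H1 : [set: H] = [set 1%g])
  (muH1 : muH [set 1%g] = 1%E).
Local Notation G := (semidirect tau).
Local Notation muG := (semidirect_haar tau muH muK delta).

Let all1 (h : H) : h = 1%g.
Proof. by have : [set: H] h by []; rewrite H1. Qed.

Let delta1 : delta 1%g = 1.
Proof.
have d0 : delta 1%g != 0 by rewrite gt_eqF// (delta_gt0 hdelta).
by apply: (mulfI d0); rewrite -(deltaM hdelta) mulg1 mulr1.
Qed.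

Let integral_one (F : H -> \bar R) : (\int[muH]_h F h = F 1%g)%E.
Proof.
rewrite (eq_integral (cst (F 1%g))) => [|h _]; last by rewrite (all1 h).
by rewrite integral_cst// H1 muH1 mule1.
Qed.

Let cintegral_one (F : H -> R[i]) : cintegral muH F = F 1%g.
Proof. by rewrite /cintegral !integral_one /=; case: (F 1%g). Qed.

Lemma semidirect_haar_trivial :
  muG = pushforward muK (fun k : borel K => (1%g, k) : borel G).
Proof.
apply/funext => E; rewrite /semidirect_haar integral_one delta1 mul1e.
by congr (muK _); apply/seteqP; split => k; rewrite /xsection /= inE.
Qed.

Lemma tau_conv_trivial (f g : G -> R[i]) (x : G) : L1 muG f -> L1 muG g ->
  tau_conv muH muK delta f g x = convolution muG f g x.
Proof.
move=> [/integrableP[/measurable_EFinP mRf _]].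
move=> /integrableP[/measurable_EFinP mIf _].
move=> [/integrableP[/measurable_EFinP mRg _]].
move=> /integrableP[/measurable_EFinP mIg _].
case: x => h k; rewrite (all1 h) {h}.
rewrite /tau_conv /tau_conv_r /tau_conv_l !cintegral_one /= delta1 mulr1.
rewrite -mulr2n -[X in _ * X]mulr_natl mulrA mulVf ?mul1r ?pnatr_eq0//.
(* Continuity of [shift] makes the integrand of the convolution on the
   semidirect product measurable. *)
pose shift (y : G) : G := (y^-1 * (1%g, k))%g.
have mshift : measurable_fun [set: borel G] (shift : borel G -> borel G).
  apply: continuous_borel => y.
  apply: (cvg_comp (fun y : G => (y, (1%g, k) : G)) (fun p => p.1^-1 * p.2)%g).
    exact: (cvg_pair (@cvg_id _ _) (@cvg_cst G _ G (nbhs y) _)).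
  exact: (@ldiv_continuous G (y, (1%g, k))).
have mgshift (r : G -> R) : measurable_fun [set: borel G] (r : borel G -> R) ->
    measurable_fun [set: borel G] (fun y => r (shift y)).
  by move=> mr; exact: measurableT_comp mr mshift.
rewrite /convolution semidirect_haar_trivial.
rewrite [RHS](@cintegral_pushforward _ _ (borel K) (borel G)).
- congr cintegral; apply/funext => s /=; congr (_ * g _).
  rewrite -[RHS]/(sd_mul (sd_inv ((1%g, s) : G)) (1%g, k)).
  by rewrite /sd_mul /sd_inv /= invg1 mulg1 !tau_id.
- apply: continuous_borel => s.
  exact: (cvg_pair (@cvg_cst H 1%g K (nbhs s) _) (@cvg_id _ _)).
- rewrite (_ : (fun y : G => _) = (fun y : borel G =>
    complex.Re (f y) * complex.Re (g (shift y))
    - complex.Im (f y) * complex.Im (g (shift y)))); last first.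
    by apply/funext => y /=; rewrite /shift; case: (f y) => ? ?; case: (g _).
  apply: measurable_funB.
    exact: measurable_funM mRf (mgshift _ mRg).
  exact: measurable_funM mIf (mgshift _ mIg).
- rewrite (_ : (fun y : G => _) = (fun y : borel G =>
    complex.Re (f y) * complex.Im (g (shift y))
    + complex.Im (f y) * complex.Re (g (shift y)))); last first.
    by apply/funext => y /=; rewrite /shift; case: (f y) => ? ?; case: (g _).
  apply: measurable_funD.
    exact: measurable_funM mRf (mgshift _ mIg).
  exact: measurable_funM mIf (mgshift _ mRg).
Qed.

End trivial_factor.

Theorem corollary3p20 (R : realType) (H K : topologicalGroupType)
    (lcscH : lcsc_group H) (lcscK : lcsc_group K)
    (tau : cont_hom_Aut H K)
    (muH : {measure set (borel H) -> \bar R})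
    (muK : {measure set (borel K) -> \bar R})
    (haarH : left_haar muH) (haarK : left_haar muK)
    (normH : [set: H] = [set 1%g] -> muH [set 1%g] = 1%E)
    (delta : H -> R) (hdelta : is_delta tau muK delta) :
  let muG := semidirect_haar tau muH muK delta in
  (forall f g : semidirect tau -> R[i], L1 muG f -> L1 muG g ->
     {ae muG, forall x, tau_conv muH muK delta f g x = convolution muG f g x}) <->
  [set: H] = [set 1%g].
Proof.
move=> muG.
have [mu muE] := semidirect_haar_measure muH lcscH lcscK haarK hdelta.
split=> [conv_eq|H1 f g Lf Lg]; last first.
  rewrite /muG -muE; apply: aeW => x /=; rewrite muE.
  exact: (tau_conv_trivial hdelta H1 (normH H1) x Lf Lg).
apply/seteqP; split=> // a _; apply: contrapT => /eqP a1.
have [D [oD D1] Doo] := haar_locally_finite lcscK haarK 1%g.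
have [W [oW W1] WD] := nbhs_ldiv 1%g (open_nbhs_nbhs (conj oD D1)).
(* The intersection with [D] gives [C] finite measure. *)
pose C := W `&` D; have oC : open C by exact: openI.
have CD s k : C s -> C k -> D (s^-1 * k)%g by move=> [Ws _] [Wk _]; exact: WD.
have Coo : (muK C < +oo)%E.
  have [mC mD] := (borel_open oC, borel_open oD).
  apply: le_lt_trans Doo; apply: le_measure; rewrite ?inE//.
  exact: subIsetr.
have C0 : (0 < muK C)%E.
  have C1 : C !=set0 by exists 1%g; split.
  exact: (haar_open_gt0 lcscK haarK oC C1).
have [V [oV Va] [VV /andP[V0 Voo]]] := separating_nbhd lcscH haarH hdelta a1.
have := conv_eq _ _
  (rect_indic_L1 lcscH lcscK haarK hdelta oV oC Voo Coo)
  (rect_indic_L1 lcscH lcscK haarK hdelta oV oD Voo Doo).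
rewrite /muG -muE => /negligibleS VC0.
have {VC0} : mu (V `*` C) = 0%E.
  (* The convolutions differ at every point of V x C. *)
  apply/negligibleP; first by apply: borel_open; exact: open_setX.
  apply: VC0 => -[h k] [/= Vh Ck]; rewrite /= muE.
  rewrite (rect_indic_tau_conv hdelta oV oC CD)//.
  rewrite (rect_indic_convolution muH lcscH lcscK)//.
  move=> /(congr1 (@complex.Re R))/eqP /=.
  by rewrite mulf_eq0 !gt_eqF// fine_gt0// ?V0 ?C0.
rewrite muE (semidirect_haar_setX muH hdelta oV oC) => /eqP.
by rewrite mule_eq0 !gt_eqF.
Qed.
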